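(* Let $\rho^0\in\mathcal{P}_o(G)$ and let $\rho(t)$, $t\ge0$, be the solution with $\rho(0)=\rho^0$ of $$\frac{d\rho_i}{dt}=\frac{1}{\Delta x^2}\Big\{\sum_{j\in N(i)}\rho_j\,(F_j(\rho)-F_i(\rho))_+-\sum_{j\in N(i)}\rho_i\,(F_i(\rho)-F_j(\rho))_+\Big\},\qquad i\in V.$$ Assume that $\lim_{t\to\infty}\rho(t)=\rho^\infty$ where $\rho^\infty$ is an isolated equilibrium, and that $\lambda_{\mathcal{F}}(\rho^\infty)>0$. Then there exists a constant $C=C(\rho^0,G)>0$, depending on $\rho^0$ and $G$, such that for all $t\ge 0$ $$\mathcal{F}(\rho(t))-\mathcal{F}(\rho^\infty)\le e^{-Ct}\big(\mathcal{F}(\rho^0)-\mathcal{F}(\rho^\infty)\big).$$ Moreover, the asymptotic convergence rate is $2\lambda_{\mathcal{F}}(\rho^\infty)$, i.e. for any sufficiently small $\epsilon>0$ there exists a time $T>0$, depending on $\epsilon$ and $\rho^0$, such that for all $t>T$ $$\mathcal{F}(\rho(t))-\mathcal{F}(\rho^\infty)\le e^{-2(\lambda_{\mathcal{F}}(\rho^\infty)-\epsilon)(t-T)}\big(\mathcal{F}(\rho(T))-\mathcal{F}(\rho^\infty)\big).$$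
   Context: $G=(V,E)$ is a finite, undirected, simple, connected graph with $V=\{1,\dots,n\}$, $n\ge2$; $E$ is a set of ordered pairs containing both $(i,j)$ and $(j,i)$ for each edge (sums over $E$ run over both orientations), and $N(i)=\{j\in V:(i,j)\in E\}$. $\Delta x>0$ and $\beta>0$ are constants, $(v_i)$ is a real vector, $(w_{ij})$ is a real symmetric matrix, and $(a)_+=\max\{a,0\}$. $\mathcal{P}_o(G)=\{\rho\in\mathbb{R}^n:\sum_i\rho_i=1,\ \rho_i>0\ \forall i\in V\}$. For every $\rho^0\in\mathcal{P}_o(G)$ the ODE system in the claim has a unique solution $\rho:[0,\infty)\to\mathcal{P}_o(G)$ with $\rho(0)=\rho^0$, and its components are bounded below by a positive constant depending on $\rho^0$. Discrete free energy: $\mathcal{F}(\rho)=\sum_i v_i\rho_i+\frac12\sum_{i,j}w_{ij}\rho_i\rho_j+\beta\sum_i\rho_i\log\rho_i$, $F_i(\rho)=\frac{\partial}{\partial\rho_i}\mathcal{F}(\rho)=v_i+\sum_j w_{ij}\rho_j+\beta\log\rho_i+\beta$. With $f_{ij}=\frac{\partial^2}{\partial\rho_i\partial\rho_j}\mathcal{F}(\rho)$ and $h_{ij,kl}=\frac{f_{ik}+f_{jl}-f_{il}-f_{jk}}{\Delta x^2}$ for $i,j,k,l\in V$, define for $\rho\in\mathcal{P}_o(G)$ $$\lambda_{\mathcal{F}}(\rho)=\min_{\Phi\in D}\ \sum_{(i,j)\in E}\sum_{(k,l)\in E}h_{ij,kl}\Big(\frac{\Phi_i-\Phi_j}{\Delta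 x}\Big)_+\rho_i\Big(\frac{\Phi_k-\Phi_l}{\Delta x}\Big)_+\rho_k,$$ $$D=\Big\{\Phi\in\mathbb{R}^n:\ \sum_{(i,j)\in E}\Big(\frac{\Phi_i-\Phi_j}{\Delta x}\Big)_+^2\rho_i=1\Big\}.$$ *)

(* Defs.v *)
From HB Require Import structures.
From mathcomp Require Import all_boot all_order all_algebra.
From mathcomp Require Import all_classical all_reals all_analysis.
Import Order.TTheory GRing.Theory Num.Theory numFieldNormedType.Exports.
Set Implicit Arguments.
Unset Strict Implicit.
Unset Printing Implicit Defensive.

Local Open Scope classical_set_scope.
Local Open Scope ring_scope.

(* A graph on the vertices 'I_n is given by its adjacency relation; the set E
   of ordered pairs is then [set (i, j) | e i j], and a sum over E is a sum
   over i and over the neighbours j of i. *)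
Definition simple_connected_graph (n : nat) (e : rel 'I_n) : Prop :=
  [/\ symmetric e, irreflexive e & forall i j : 'I_n, connect e i j].

Definition pos_part (R : realType) (a : R) : R := Num.max a 0.

Definition prob_interior (R : realType) (n : nat) : set 'rV[R]_n :=
  [set rho | \sum_(i < n) rho 0 i = 1 /\ forall i, 0 < rho 0 i].

(* Since [ln x = 0] for [x <= 0] this is a total function, but only its values
   (and derivatives) on the open orthant are meaningful. *)
Definition free_energy (R : realType) (n : nat) (beta : R) (v : 'rV[R]_n)
    (w : 'M[R]_n) (rho : 'rV[R]_n) : R :=
  \sum_(i < n) v 0 i * rho 0 i
  + 2^-1 * \sum_(i < n) \sum_(j < n) w i j * rho 0 i * rho 0 j
  + beta * \sum_(i < n) rho 0 i * ln (rho 0 i).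

Definition partial (R : realType) (n : nat) (i : 'I_n) (f : 'rV[R]_n -> R) :
  'rV[R]_n -> R := 'D_(delta_mx 0 i) f.

(* F_i.  At a point of the open orthant, and for symmetric w, its value is
   v_i + \sum_j w_ij rho_j + beta * ln rho_i + beta. *)
Definition energy_grad (R : realType) (n : nat) (beta : R) (v : 'rV[R]_n)
    (w : 'M[R]_n) (i : 'I_n) : 'rV[R]_n -> R :=
  partial i (free_energy beta v w).

Definition energy_hess (R : realType) (n : nat) (beta : R) (v : 'rV[R]_n)
    (w : 'M[R]_n) (i j : 'I_n) : 'rV[R]_n -> R :=
  partial i (partial j (free_energy beta v w)).

Definition fp_field (R : realType) (n : nat) (e : rel 'I_n) (dx beta : R)
    (v : 'rV[R]_n) (w : 'M[R]_n) (rho : 'rV[R]_n) : 'rV[R]_n :=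
  let F i := energy_grad beta v w i rho in
  \row_i ((dx ^+ 2)^-1 *
          (\sum_(j | e i j) rho 0 j * pos_part (F j - F i)
           - \sum_(j | e i j) rho 0 i * pos_part (F i - F j))).

(* Solutions of the ODE on [0, +oo[ in P_o(G): continuous on [0, +oo[ and
   satisfying the ODE for t > 0.  (By the mean value theorem the ODE then also
   holds at t = 0 with a right derivative.)  Values of [rho] at negative times
   are irrelevant. *)
Definition fp_solution (R : realType) (n : nat) (e : rel 'I_n) (dx beta : R)
    (v : 'rV[R]_n) (w : 'M[R]_n) (rho0 : 'rV[R]_n) (rho : R -> 'rV[R]_n) :
    Prop :=
  [/\ rho 0 = rho0,
      forall t : R, 0 <= t -> prob_interior (rho t),
      {within `[0, +oo[, continuous rho} &
      forall t : R, 0 < t ->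
        is_derive t 1 rho (fp_field e dx beta v w (rho t))].

Definition fp_equilibrium (R : realType) (n : nat) (e : rel 'I_n)
    (dx beta : R) (v : 'rV[R]_n) (w : 'M[R]_n) : set 'rV[R]_n :=
  [set rho | prob_interior rho /\ fp_field e dx beta v w rho = 0].

Definition hcoef (R : realType) (n : nat) (dx beta : R) (v : 'rV[R]_n)
    (w : 'M[R]_n) (rho : 'rV[R]_n) (i j k l : 'I_n) : R :=
  let f a b := energy_hess beta v w a b rho in
  (f i k + f j l - f i l - f j k) / dx ^+ 2.

Definition lambda_dom (R : realType) (n : nat) (e : rel 'I_n) (dx : R)
    (rho : 'rV[R]_n) : set 'rV[R]_n :=
  [set Phi | \sum_(i < n) \sum_(j | e i j)
               pos_part ((Phi 0 i - Phi 0 j) / dx) ^+ 2 * rho 0 i = 1].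

Definition lambda_form (R : realType) (n : nat) (e : rel 'I_n) (dx beta : R)
    (v : 'rV[R]_n) (w : 'M[R]_n) (rho Phi : 'rV[R]_n) : R :=
  \sum_(i < n) \sum_(j | e i j) \sum_(k < n) \sum_(l | e k l)
    hcoef dx beta v w rho i j k l *
    (pos_part ((Phi 0 i - Phi 0 j) / dx) * rho 0 i) *
    (pos_part ((Phi 0 k - Phi 0 l) / dx) * rho 0 k).

(* Set to 0 when A has no least element.  In the definition of [lambdaF] below
   the least element exists as soon as rho has positive coordinates, dx > 0 and
   the graph is connected with at least two vertices: lambda_form is continuous
   and invariant under Phi + constant, and lambda_dom is compact modulo
   constants. *)
Definition set_min (R : realType) (A : set R) : R :=
  xget 0 (A `&` lbound A).

Definition lambdaF (R : realType) (n : nat) (e : rel 'I_n) (dx beta : R)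
    (v : 'rV[R]_n) (w : 'M[R]_n) (rho : 'rV[R]_n) : R :=
  set_min (lambda_form e dx beta v w rho @` lambda_dom e dx rho).

(* Main.v *)
Require Import Defs.
From HB Require Import structures.
From mathcomp Require Import all_boot all_order all_algebra.
From mathcomp Require Import all_classical all_reals all_analysis.
From mathcomp Require Import ring lra.
Import Order.TTheory GRing.Theory Num.Theory numFieldNormedType.Exports.
Set Implicit Arguments.
Unset Strict Implicit.
Unset Printing Implicit Defensive.

Local Open Scope classical_set_scope.
Local Open Scope ring_scope.

(** Write [g t] for the free energy along the solution and [D t] for the
    dissipation, the sum of [((F_i - F_j) / dx)_+ ^ 2 * rho_i] over the oriented
    edges. The equation is the gradient flow of the free energy for a discrete
    transport metric, and the argument is the entropy method of Bakry and Emery.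

    Summation by parts on the graph gives [g' = - D] ([energy_flow]). The square
    of a positive part is continuously differentiable, so [D] can be
    differentiated as well ([is_derive_dissipation_flow]):
    [D' = - 2 * Q + V], where [Q] is the form of [lambda_form] evaluated at the
    potential [Phi = F], and [V], the sum of [((F_i - F_j) / dx)_+ ^ 2 * rho_i'],
    comes from the motion of the weights.

    Near the limit density the coefficients of [Q] are close to their limits,
    the velocity [rho'] is close to 0, and [D] controls the sum of the squared
    slopes because the densities are bounded below. Hence [V] and the variation
    of [Q] are small multiples of [D], and by homogeneity the limit form is at
    least [lambdaF] times the limit dissipation ([lambda_form_ge]). So
    [D' <= - 2 * (lambdaF - eps) * D] for large times ([asymptotic_rate]).
    Integrating from [t] to infinity, where [D] vanishes, gives
    [D >= 2 * (lambdaF - eps) * (g - ginf)], and Gronwall's inequality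
    for [g - ginf] is the asymptotic statement ([asymptotic_decay]).

    For the bound from time 0 it suffices that [D >= C * (g - ginf)] for some
    [C > 0] at all times. On a bounded time interval [|D'| <= K * D]
    ([dissipation_bounded_rate]), so [D] is bounded below there by a positive
    constant unless it vanishes at time 0, in which case the energy has already
    reached its limit ([global_decay]). *)

(** * Calculus in one variable *)

Section Calculus.
Variable R : realType.
Implicit Types (f g : R -> R) (t : R).

Lemma is_derive_add f g t a b : is_derive t 1 f a -> is_derive t 1 g b ->
  is_derive t 1 (fun s => f s + g s) (a + b).
Proof. by move=> df dg; exact: is_deriveD. Qed.

Lemma is_derive_mul f g t a b : is_derive t 1 f a -> is_derive t 1 g b ->
  is_derive t 1 (fun s => f s * g s) (a * g t + f t * b).
Proof.
move=> df dg; apply: is_derive_eq (is_deriveM df dg) _.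
by rewrite addrC /GRing.scale /= mulrC.
Qed.

Lemma is_derive_mull c f t a : is_derive t 1 f a ->
  is_derive t 1 (fun s => c * f s) (c * a).
Proof.
move=> df; apply: is_derive_eq (is_derive_mul (is_derive_cst c t 1) df) _.
by rewrite mul0r add0r.
Qed.

Lemma is_derive_bigsum (I : Type) (r : seq I) (P : pred I) (f : I -> R -> R)
    t (df : I -> R) : (forall i, is_derive t 1 (f i) (df i)) ->
  is_derive t 1 (fun s => \sum_(i <- r | P i) f i s) (\sum_(i <- r | P i) df i).
Proof.
move=> dfi; elim: r => [|i r IH].
  rewrite big_nil (_ : (fun s => _) = cst 0); first exact: is_derive_cst.
  by apply/funext => s; rewrite big_nil.
rewrite big_cons (_ : (fun s => _) = fun s =>
    (if P i then f i s else 0) + \sum_(j <- r | P j) f j s); last first.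
  by apply/funext => s; rewrite big_cons; case: (P i); rewrite ?add0r.
by case: (P i); [exact: is_derive_add | under eq_fun do rewrite add0r].
Qed.

(** Squaring removes the corner of the positive part at the origin. *)
Lemma is_derive_pos_part_sqr t :
  is_derive t 1 (fun s : R => pos_part s ^+ 2) (2 * pos_part t).
Proof.
rewrite /pos_part; have [t0|t0|->] := ltgtP t 0.
- rewrite mulr0; apply: near_eq_is_derive (is_derive_cst 0 t 1).
  near=> s; rewrite max_r ?expr0n //; apply/ltW.
  by near: s; exact: lt_nbhsl.
- have d2 : is_derive t 1 (fun s : R => s ^+ 2) (2 * t).
    have did := is_derive_id t (1 : R).
    by apply: is_derive_eq (is_derive_mul did did) _; rewrite mul1r mulr1 mulr_natl.
  apply: near_eq_is_derive d2; near=> s; rewrite max_l //; apply/ltW.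
  by near: s; exact: lt_nbhsr.
- rewrite mulr0.
  suff l0 : (fun h : R => h^-1 *
      (Num.max (h * 1 + 0) 0 ^+ 2 - Num.max 0 0 ^+ 2)) h @[h --> 0^'] --> (0 : R).
    by split; [apply/cvg_ex; exists 0 | apply/cvg_lim].
  apply/cvgrPdist_le => eps eps0; near=> h.
  rewrite sub0r normrN maxxx expr0n subr0 addr0 mulr1 normrM.
  have h0 : h != 0 by near: h; exact: nbhs_dnbhs_neq.
  have : `|h| <= eps by near: h; exact: dnbhs0_le.
  apply: le_trans; rewrite normfV ler_pdivrMl ?normr_gt0// -expr2 normrX.
  by rewrite lerXn2r ?nnegrE//; case: (leP h 0) => // _; rewrite normr0.
Unshelve. all: by end_near. Qed.

Lemma continuous_pos_part : continuous (@pos_part R).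
Proof. by move=> x; apply: continuous_max; [exact: cvg_id | exact: cvg_cst]. Qed.

Lemma within_segment (a b : R) f : 0 <= a -> {within `[0, +oo[, continuous f} ->
  {within `[a, b], continuous f}.
Proof.
move=> a0; apply: continuous_subspaceW => x /=; rewrite !in_itv /= => /andP[ax _].
by rewrite (le_trans a0 ax).
Qed.

Lemma bounded_on_segment (b : R) f : {within `[0, +oo[, continuous f} ->
  exists B : R, forall t, 0 <= t <= b -> `|f t| <= B.
Proof.
move=> cf; have [b0|b0] := ltP b 0.
  by exists 0 => t /andP[t0 tb]; have := le_lt_trans (le_trans t0 tb) b0; rewrite ltxx.
have cN : {within `[0, b], continuous (fun t => `|f t|)}.
  move=> x; apply: cvg_norm; exact: (within_segment (lexx 0) cf).
have [c _ cmax] := EVT_max b0 cN.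
by exists `|f c| => t t0b; apply: cmax; rewrite in_itv.
Qed.

(** Gronwall's inequality, because [expR (c * t) * u t] does not increase. The sign
    of [c] is arbitrary: a negative rate gives an upper bound on growth. *)
Lemma gronwall_decay (u du : R -> R) (c a b : R) : 0 <= a -> a <= b ->
  {within `[0, +oo[, continuous u} ->
  (forall t, 0 < t -> is_derive t 1 u (du t)) ->
  (forall t, a < t < b -> du t <= - c * u t) ->
  u b <= expR (- (c * (b - a))) * u a.
Proof.
move=> a0 ab cu dudt ule.
pose f := fun t => expR (c * t) * u t.
have df t : 0 < t -> is_derive t 1 f (expR (c * t) * (c * u t + du t)).
  move=> t0; have de : is_derive t 1 (fun s => expR (c * s)) (expR (c * t) * c).
    have := is_derive_mull c (is_derive_id t 1); rewrite mulr1 => dc.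
    exact: (is_derive1_comp (is_derive_expR _) dc).
  by apply: is_derive_eq (is_derive_mul de (dudt _ t0)) _; ring.
suff fba : f b <= f a.
  have -> : u b = expR (- (c * b)) * f b by rewrite /f mulrA -expRD addNr expR0 mul1r.
  have -> : expR (- (c * (b - a))) * u a = expR (- (c * b)) * f a.
    by rewrite /f mulrA -expRD; congr (expR _ * _); ring.
  by rewrite ler_pM2l ?expR_gt0.
apply: (@ler0_derive1_le_cc _ f a b); rewrite ?in_itv /= ?lexx ?ab //.
- move=> t; rewrite in_itv /= => /andP[at_ _].
  by apply: (@ex_derive _ _ _ _ _ _ _ (df _ _)); exact: le_lt_trans at_.
- move=> t; rewrite in_itv /= => /andP[at_ tb]; rewrite derive1E.
  rewrite (@derive_val _ _ _ _ _ _ _ (df _ (le_lt_trans a0 at_))).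
  have := ule t; rewrite at_ tb => /(_ isT) duc.
  by rewrite mulr_ge0_le0 ?expR_ge0 //; lra.
- move=> x; apply: cvgM; last exact: (within_segment a0 cu).
  apply: (@continuous_subspaceT _ _ `[a, b] (fun t => expR (c * t))) => y.
  apply: (@continuous_comp _ _ _ ( *%R c) expR); last exact: continuous_expR.
  exact: mulrl_continuous.
Qed.

End Calculus.

(** * The free energy on the open orthant *)

Section FreeEnergy.
Variables (R : realType) (n : nat) (beta : R) (v : 'rV[R]_n) (w : 'M[R]_n).
Implicit Types (x : 'rV[R]_n) (i j : 'I_n).

(** The gradient and the Hessian of the free energy in closed form. They are the
    partial derivatives only on the open orthant, where [ln] is differentiable. *)
Definition egrad i x : R :=
  v 0 i + \sum_j w i j * x 0 j + beta * (ln (x 0 i) + 1).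

Definition ehess i j x : R := w j i + beta * ((j == i)%:R / x 0 j).

Section AlongPath.
Variables (y : R -> 'rV[R]_n) (t : R) (d : 'I_n -> R).
Hypothesis dy : forall i, is_derive t 1 (fun s => y s 0 i) (d i).
Hypothesis y0 : forall i, 0 < y t 0 i.

Lemma is_derive_ln_path i : is_derive t 1 (fun s => ln (y s 0 i)) ((y t 0 i)^-1 * d i).
Proof. exact: is_derive1_comp (is_derive1_ln (y0 i)) (dy i). Qed.

Lemma is_derive_egrad i : is_derive t 1 (fun s => egrad i (y s))
  (\sum_j w i j * d j + beta * (d i / y t 0 i)).
Proof.
have dv := is_derive_add (is_derive_cst (v 0 i) t (1 : R))
  (is_derive_bigsum (index_enum 'I_n) xpredT (fun j => is_derive_mull (w i j) (dy j))).
have dl := is_derive_mull beta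
  (is_derive_add (is_derive_ln_path i) (is_derive_cst (1 : R) t (1 : R))).
apply: is_derive_eq (is_derive_add dv dl) _.
by rewrite add0r addr0 [_ / _]mulrC.
Qed.

Lemma is_derive_free_energy : w^T = w ->
  is_derive t 1 (fun s => free_energy beta v w (y s)) (\sum_i egrad i (y t) * d i).
Proof.
move=> wT.
have dv := is_derive_bigsum (index_enum 'I_n) xpredT
  (fun i => is_derive_mull (v 0 i) (dy i)).
have dw := is_derive_mull 2^-1 (is_derive_bigsum (index_enum 'I_n) xpredT (fun i =>
  is_derive_bigsum (index_enum 'I_n) xpredT (fun j =>
    is_derive_mul (is_derive_mull (w i j) (dy i)) (dy j)))).
have dl := is_derive_mull beta (is_derive_bigsum (index_enum 'I_n) xpredT
  (fun i => is_derive_mul (dy i) (is_derive_ln_path i))).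
apply: is_derive_eq (is_derive_add (is_derive_add dv dw) dl) _.
(* The symmetry of [w] identifies the two halves of the product rule. *)
have -> : \sum_i \sum_j (w i j * d i * y t 0 j + w i j * y t 0 i * d j) =
    2 * \sum_i (\sum_j w i j * y t 0 j) * d i.
  under eq_bigr do rewrite big_split /=.
  rewrite big_split /= [X in _ + X]exchange_big /= mulr_natl mulr2n.
  congr (_ + _); apply: eq_bigr => i _; rewrite mulr_suml; apply: eq_bigr => j _.
    by ring.
  by rewrite -[in w j i]wT mxE.
rewrite mulrA mulVf ?pnatr_eq0// mul1r mulr_sumr -!big_split /=.
apply: eq_bigr => i _; rewrite /egrad mulrA mulfV ?gt_eqF ?y0// mul1r; ring.
Qed.

End AlongPath.

(** Reduces partial derivatives to derivatives along a path, so that one chain rule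
    serves both for them and for solutions of the equation. *)
Lemma directional_derivative (f : 'rV[R]_n -> R) x (d : 'rV[R]_n) (a : R) :
  is_derive (0 : R) (1 : R) (fun h : R => f (h *: d + x)) a -> 'D_d f x = a.
Proof.
move=> dfa; rewrite -(@derive_val _ _ _ _ _ _ _ dfa) /derive.
congr (lim _); apply (f_equal (fun q => fmap q _)); apply/funext => h /=.
by rewrite addr0 scale0r add0r /GRing.scale /= mulr1.
Qed.

Lemma is_derive_coord_line i x j :
  is_derive (0 : R) (1 : R) (fun h : R => (h *: delta_mx 0 i + x) 0 j) (j == i)%:R.
Proof.
rewrite (_ : (fun h => _) = fun h : R => (j == i)%:R * h + x 0 j); last first.
  by apply/funext => h; rewrite !mxE eqxx /= mulrC.
have := is_derive_add (is_derive_mull (j == i)%:R (is_derive_id 0 (1 : R)))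
  (is_derive_cst (x 0 j) 0 (1 : R)).
by rewrite mulr1 addr0.
Qed.

Lemma energy_gradE i x : w^T = w -> (forall j, 0 < x 0 j) ->
  energy_grad beta v w i x = egrad i x.
Proof.
move=> wT x0; apply: directional_derivative.
have := @is_derive_free_energy (fun h => h *: delta_mx 0 i + x) 0 _
  (is_derive_coord_line i x) _ wT.
rewrite scale0r add0r => /(_ x0) /is_derive_eq; apply.
rewrite (bigD1 i) //= eqxx mulr1 big1 ?addr0// => j /negPf ->.
by rewrite mulr0.
Qed.

Lemma near_orthant x : (forall j, 0 < x 0 j) ->
  \forall y \near nbhs x, forall j, 0 < (y : 'rV[R]_n) 0 j.
Proof.
move=> x0; apply: filter_forall => j.
exact: (@coord_continuous R 1 n 0 j x) (lt_nbhsr (x0 j)).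
Qed.

Lemma energy_hessE i j x : w^T = w -> (forall k, 0 < x 0 k) ->
  energy_hess beta v w i j x = ehess i j x.
Proof.
move=> wT x0; rewrite /energy_hess /partial.
(* The closed form of the inner partial derivative is valid only near [x]. *)
rewrite (@near_eq_derive _ _ _ _ (egrad j)); last first.
  near=> y; apply: energy_gradE => //; near: y; exact: near_orthant.
apply: directional_derivative.
have := @is_derive_egrad (fun h => h *: delta_mx 0 i + x) 0 _
  (is_derive_coord_line i x) _ j.
rewrite scale0r add0r => /(_ x0) /is_derive_eq; apply.
rewrite (bigD1 i) //= eqxx mulr1 big1 ?addr0// => k /negPf ->.
by rewrite mulr0.
Unshelve. all: by end_near. Qed.

End FreeEnergy.

(** * Dissipation along the flow *)

Section Dissipation.
Variables (R : realType) (n : nat) (e : rel 'I_n) (dx beta : R).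
Variables (v : 'rV[R]_n) (w : 'M[R]_n).
Implicit Types (x Phi : 'rV[R]_n) (i j : 'I_n) (u z : 'I_n * 'I_n).

Definition edge u : bool := e u.1 u.2.

Definition potential x : 'rV[R]_n := \row_i egrad beta v w i x.

Definition slope Phi u : R := pos_part ((Phi 0 u.1 - Phi 0 u.2) / dx).

Definition dissipation x Phi : R := \sum_(u | edge u) slope Phi u ^+ 2 * x 0 u.1.

(** The vector field of the equation, with one factor [dx^-1] absorbed in the slopes. *)
Definition efield i x : R := dx^-1 * \sum_(j | e i j)
  (slope (potential x) (j, i) * x 0 j - slope (potential x) (i, j) * x 0 i).

(** The weights [x_i * x_k] are kept with the Hessian, so that [edge_form] is a
    quadratic form in the slopes whose coefficients depend continuously on [x]. *)
Definition coef x u z : R :=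
  (ehess beta w u.1 z.1 x + ehess beta w u.2 z.2 x
   - ehess beta w u.1 z.2 x - ehess beta w u.2 z.1 x) / dx ^+ 2
  * (x 0 u.1 * x 0 z.1).

Definition edge_form x Phi : R :=
  \sum_(u | edge u) \sum_(z | edge z) coef x u z * (slope Phi u * slope Phi z).

Lemma pos_partZ (c a : R) : 0 <= c -> pos_part (c * a) = c * pos_part a.
Proof. by move=> c0; rewrite /pos_part maxr_pMr ?mulr0. Qed.

Lemma mul_pos_part (a : R) : a * pos_part a = pos_part a ^+ 2.
Proof. by rewrite /pos_part; case: (ltrgt0P a) => [_|_|->]; rewrite ?expr2 ?mulr0. Qed.

Hypotheses (dx0 : 0 < dx) (esym : symmetric e) (wT : w^T = w).

Lemma ehess_sym i j x : ehess beta w i j x = ehess beta w j i x.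
Proof.
rewrite /ehess -[in w j i]wT mxE eq_sym; case: eqVneq => [->//|_].
by rewrite !mul0r.
Qed.

Lemma sum_edgeE (f : 'I_n -> 'I_n -> R) :
  \sum_i \sum_(j | e i j) f i j = \sum_(u | edge u) f u.1 u.2.
Proof. exact: pair_big_dep. Qed.

Section Orthant.
Variable x : 'rV[R]_n.
Hypothesis x0 : forall i, 0 < x 0 i.

Lemma fp_fieldE i : fp_field e dx beta v w x 0 i = efield i x.
Proof.
rewrite mxE /efield -exprVn expr2 -mulrA -sumrB; congr (_ * _).
rewrite mulr_sumr; apply: eq_bigr => j _.
rewrite !energy_gradE// /slope /= !mxE.
move: (egrad _ _ _ i x) (egrad _ _ _ j x) => a b.
by rewrite ![_ / dx]mulrC !pos_partZ ?invr_ge0 ?ltW//; ring.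
Qed.

Lemma lambda_domE : lambda_dom e dx x = [set Phi | dissipation x Phi = 1].
Proof.
have dE Phi : \sum_(i < n) \sum_(j | e i j)
    pos_part ((Phi 0 i - Phi 0 j) / dx) ^+ 2 * x 0 i = dissipation x Phi.
  exact: (sum_edgeE (fun i j => pos_part ((Phi 0 i - Phi 0 j) / dx) ^+ 2 * x 0 i)).
by apply/seteqP; split => Phi; rewrite /lambda_dom /= dE.
Qed.

Lemma lambda_formE Phi : lambda_form e dx beta v w x Phi = edge_form x Phi.
Proof.
rewrite /edge_form -(sum_edgeE (fun i j => \sum_(z | edge z)
  coef x (i, j) z * (slope Phi (i, j) * slope Phi z))).
apply: eq_bigr => i _; apply: eq_bigr => j _.
rewrite -(sum_edgeE (fun k l =>
  coef x (i, j) (k, l) * (slope Phi (i, j) * slope Phi (k, l)))).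
apply: eq_bigr => k _; apply: eq_bigr => l _.
rewrite /hcoef /coef /slope /= !energy_hessE//.
move: (pos_part _) (pos_part _) => a b; ring.
Qed.

(** Summation by parts on the graph: what leaves a vertex along an edge enters at
    the other end. *)
Lemma sum_efield (a : 'I_n -> R) : \sum_i a i * efield i x =
  - \sum_(u | edge u) (a u.1 - a u.2) / dx * (slope (potential x) u * x 0 u.1).
Proof.
pose m i j := slope (potential x) (i, j) * x 0 i.
rewrite -(sum_edgeE (fun i j => (a i - a j) / dx * m i j)).
transitivity (\sum_i \sum_(j | e i j) a i / dx * m j i
            - \sum_i \sum_(j | e i j) a i / dx * m i j).
  rewrite -sumrB; apply: eq_bigr => i _; rewrite -sumrB /efield mulrA mulr_sumr.
  by apply: eq_bigr => j _; rewrite -mulrBr.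
rewrite (exchange_big_dep xpredT) //= -sumrB -sumrN; apply: eq_bigr => i _.
under eq_bigl do rewrite esym.
by rewrite -sumrB -sumrN; apply: eq_bigr => j _; ring.
Qed.

End Orthant.

(** The flow descends the free energy: the power of [efield] against the
    gradient is minus the dissipation. *)
Lemma energy_flow x : \sum_i egrad beta v w i x * efield i x =
  - dissipation x (potential x).
Proof.
rewrite sum_efield; congr (- _); apply: eq_bigr => u _.
by rewrite mulrA -mul_pos_part /slope !mxE.
Qed.

Section AlongFlow.
Variables (y : R -> 'rV[R]_n) (t : R).
Hypothesis dy : forall i, is_derive t 1 (fun s => y s 0 i) (efield i (y t)).
Hypothesis y0 : forall i, 0 < y t 0 i.
Let P := potential (y t).

Lemma is_derive_energy_flow :
  is_derive t 1 (fun s => free_energy beta v w (y s)) (- dissipation (y t) P).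
Proof.
apply: is_derive_eq (is_derive_free_energy beta v dy y0 wT) _.
exact: energy_flow.
Qed.

(** The velocity of the potential is the Hessian applied to [efield]; summation by
    parts turns its differences along the edges into the form [edge_form], and the
    last sum is the derivative of the weights. *)
Lemma is_derive_dissipation_flow :
  is_derive t 1 (fun s => dissipation (y s) (potential (y s)))
    (- 2 * edge_form (y t) P + \sum_(u | edge u) slope P u ^+ 2 * efield u.1 (y t)).
Proof.
pose dF i := \sum_k ehess beta w k i (y t) * efield k (y t).
have dFP i : is_derive t 1 (fun s => egrad beta v w i (y s)) (dF i).
  apply: is_derive_eq (is_derive_egrad beta v w dy y0 i) _.
  rewrite /dF /ehess; under [in RHS]eq_bigr do rewrite mulrDl.
  rewrite [RHS]big_split /=; congr (_ + _).
  rewrite (bigD1 i) //= eqxx big1 ?addr0 => [|k /negPf ki].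
    by rewrite -mulrA; congr (_ * _); rewrite mul1r mulrC.
  by rewrite eq_sym ki mul0r mulr0 mul0r.
have dS u : is_derive t 1 (fun s => slope (potential (y s)) u ^+ 2)
    (2 * slope P u * (dx^-1 * (dF u.1 + - 1 * dF u.2))).
  have dd := is_derive_mull dx^-1
    (is_derive_add (dFP u.1) (is_derive_mull (- 1) (dFP u.2))).
  have := is_derive1_comp (is_derive_pos_part_sqr _) dd.
  rewrite (_ : _ \o _ = fun s => slope (potential (y s)) u ^+ 2); last first.
    by apply/funext => s /=; rewrite /slope !mxE mulN1r mulrC.
  move/is_derive_eq; apply; rewrite /slope /P !mxE.
  by congr (2 * pos_part _ * _); rewrite mulN1r mulrC.
have := is_derive_bigsum (index_enum _) edge (fun u => is_derive_mul (dS u) (dy u.1)).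
move/is_derive_eq; apply; rewrite big_split /=; congr (_ + _).
rewrite /edge_form mulr_sumr; apply: eq_bigr => u _.
have dFE i : dF i = - \sum_(z | edge z) (ehess beta w i z.1 (y t)
    - ehess beta w i z.2 (y t)) / dx * (slope P z * y t 0 z.1).
  rewrite -(sum_efield _ (fun k => ehess beta w i k (y t))).
  by apply: eq_bigr => k _; rewrite ehess_sym.
rewrite !dFE mulN1r opprK addrC -sumrB mulr_sumr mulr_sumr mulr_suml mulr_sumr.
apply: eq_bigr => z _; rewrite /coef; field.
by rewrite gt_eqF.
Qed.

End AlongFlow.

End Dissipation.

(** * Continuity on the open orthant *)

Section Continuity.
Variables (R : realType) (T : topologicalType) (x : T).
Implicit Types f g : T -> R.

Lemma continuous_at_cst (c : R) : {for x, continuous (fun _ : T => c)}.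
Proof. exact: cvg_cst. Qed.

Lemma continuous_at_add f g : {for x, continuous f} -> {for x, continuous g} ->
  {for x, continuous (fun y => f y + g y)}.
Proof. exact: cvgD. Qed.

Lemma continuous_at_sub f g : {for x, continuous f} -> {for x, continuous g} ->
  {for x, continuous (fun y => f y - g y)}.
Proof. exact: cvgB. Qed.

Lemma continuous_at_mul f g : {for x, continuous f} -> {for x, continuous g} ->
  {for x, continuous (fun y => f y * g y)}.
Proof. exact: cvgM. Qed.

Lemma continuous_at_bigsum (I : Type) (r : seq I) (P : pred I) (f : I -> T -> R) :
  (forall i, {for x, continuous (f i)}) ->
  {for x, continuous (fun y => \sum_(i <- r | P i) f i y)}.
Proof.
move=> cf; apply: (@cvg_big _ _ _ _ _ _ _ _ _ f (f ^~ x)) => [|i _]; last exact: cf.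
exact: add_continuous.
Qed.

Lemma continuous_at_comp (h : R -> R) f : {for f x, continuous h} ->
  {for x, continuous f} -> {for x, continuous (fun y => h (f y))}.
Proof. by move=> ch cf; exact: (@continuous_comp _ _ _ f h). Qed.

End Continuity.

Section OrthantContinuity.
Variables (R : realType) (n : nat) (e : rel 'I_n) (dx beta : R).
Variables (v : 'rV[R]_n) (w : 'M[R]_n) (x : 'rV[R]_n).
Hypothesis x0 : forall i, 0 < x 0 i.

Lemma continuous_at_coord i : {for x, continuous (fun y : 'rV[R]_n => y 0 i)}.
Proof. exact: coord_continuous. Qed.

Lemma continuous_at_ln_coord i :
  {for x, continuous (fun y : 'rV[R]_n => ln (y 0 i))}.
Proof.
exact: (@continuous_at_comp _ _ x (@ln R) (fun y : 'rV[R]_n => y 0 i)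
  (continuous_ln (x0 i)) (@continuous_at_coord i)).
Qed.

Lemma continuous_at_inv_coord i :
  {for x, continuous (fun y : 'rV[R]_n => (y 0 i)^-1)}.
Proof.
apply: (@continuous_at_comp _ _ _ (@GRing.inv R) (fun y : 'rV[R]_n => y 0 i)).
  by apply: inv_continuous; rewrite gt_eqF.
exact: continuous_at_coord.
Qed.

Ltac continuity_orthant := repeat first
  [ exact: continuous_at_cst | exact: continuous_at_coord
  | exact: continuous_at_ln_coord | exact: continuous_at_inv_coord
  | apply: continuous_at_bigsum => ?
  | apply: continuous_at_mul | apply: continuous_at_sub
  | apply: continuous_at_add ].

Lemma continuous_at_free_energy : {for x, continuous (free_energy beta v w)}.
Proof. rewrite /free_energy; continuity_orthant. Qed.

Lemma continuous_at_egrad i : {for x, continuous (egrad beta v w i)}.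
Proof. rewrite /egrad; continuity_orthant. Qed.

Lemma continuous_at_potential i :
  {for x, continuous (fun y => potential beta v w y 0 i)}.
Proof.
rewrite (_ : (fun y => _) = egrad beta v w i); first exact: continuous_at_egrad.
by apply/funext => y; rewrite mxE.
Qed.

Lemma continuous_at_slope u :
  {for x, continuous (fun y => slope dx (potential beta v w y) u)}.
Proof.
apply: (@continuous_at_comp _ _ _ (@pos_part R)
  (fun y => (potential beta v w y 0 u.1 - potential beta v w y 0 u.2) / dx)).
  exact: continuous_pos_part.
by continuity_orthant; exact: continuous_at_potential.
Qed.

Lemma continuous_at_dissipation :
  {for x, continuous (fun y => dissipation e dx y (potential beta v w y))}.
Proof.
rewrite /dissipation; apply: continuous_at_bigsum => u.
apply: continuous_at_mul; last exact: continuous_at_coord.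
by apply: continuous_at_mul; exact: continuous_at_slope.
Qed.

Lemma continuous_at_efield i : {for x, continuous (efield e dx beta v w i)}.
Proof.
by rewrite /efield; continuity_orthant; exact: continuous_at_slope.
Qed.

Lemma continuous_at_coef u z :
  {for x, continuous (fun y => coef dx beta w y u z)}.
Proof. rewrite /coef /ehess; continuity_orthant. Qed.

End OrthantContinuity.

(** * Decay of an energy from decay of its dissipation *)

Section EntropyDecay.
Variables (R : realType) (g D dD : R -> R) (ginf : R).
Implicit Types t s : R.
Hypotheses (cg : {within `[0, +oo[, continuous g})
  (cD : {within `[0, +oo[, continuous D})
  (dg : forall t, 0 < t -> is_derive t 1 g (- D t))
  (dDt : forall t, 0 < t -> is_derive t 1 D (dD t))
  (D0 : forall t, 0 <= t -> 0 <= D t)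
  (ginfty : g t @[t --> +oo] --> ginf) (Dinfty : D t @[t --> +oo] --> (0 : R)).

Lemma cvg_pinfty_le (u : R -> R) (l a M : R) : u t @[t --> +oo] --> l ->
  (forall b, a <= b -> u b <= M) -> l <= M.
Proof.
move=> ul uM; rewrite -(cvg_lim (@Rhausdorff R) ul); apply: limr_le.
  by apply/cvg_ex; exists l.
by near=> b; apply: uM; near: b; exact: nbhs_pinfty_ge (num_real a).
Unshelve. all: by end_near. Qed.

Lemma energy_nonincreasing a b : 0 <= a -> a <= b -> g b <= g a.
Proof.
move=> a0 ab; have := gronwall_decay a0 ab cg dg (c := 0).
rewrite mul0r oppr0 expR0 mul1r; apply => t /andP[at_ _].
by rewrite mul0r oppr_le0 D0// (le_trans a0)// ltW.
Qed.

Lemma energy_ge_limit t : 0 <= t -> ginf <= g t.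
Proof.
move=> t0; apply: (cvg_pinfty_le (a := t) ginfty) => b tb.
exact: energy_nonincreasing.
Qed.

Lemma is_derive_energy_gap t : 0 < t -> is_derive t 1 (fun s => g s - ginf) (- D t).
Proof.
move=> t0; apply: is_derive_eq (is_derive_add (dg t0) (is_derive_cst (- ginf) t 1)) _.
exact: addr0.
Qed.

Lemma continuous_energy_gap : {within `[0, +oo[, continuous (fun s => g s - ginf)}.
Proof. by move=> x; apply: cvgB; [exact: cg | exact: cvg_cst]. Qed.

(** [D - c * (g - ginf)] does not increase after time [T] and tends to 0, so it is
    nonnegative. *)
Lemma dissipation_ge_gap (c T : R) : 0 <= T ->
  (forall t, T < t -> dD t <= - c * D t) ->
  forall t, T <= t -> c * (g t - ginf) <= D t.
Proof.
move=> T0 dDle t Tt.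
pose h := fun s => D s + - c * (g s - ginf).
have ch : {within `[0, +oo[, continuous h}.
  move=> x; apply: cvgD; first exact: cD.
  by apply: cvgM; [exact: cvg_cst | exact: continuous_energy_gap].
have dh s : 0 < s -> is_derive s 1 h (dD s + - c * - D s).
  move=> s0; apply: is_derive_add (dDt s0) _.
  exact: is_derive_mull (is_derive_energy_gap s0).
have h0 : h s @[s --> +oo] --> (0 : R).
  rewrite (_ : (0 : R) = 0 + - c * (ginf - ginf)); last by rewrite subrr mulr0 addr0.
  apply: cvgD Dinfty _; apply: cvgM; first exact: cvg_cst.
  by apply: cvgB ginfty _; exact: cvg_cst.
suff : 0 <= h t by rewrite /h mulNr subr_ge0.
apply: (cvg_pinfty_le (a := t) h0) => b tb.
have := gronwall_decay (le_trans T0 Tt) tb ch dh (c := 0).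
rewrite mul0r oppr0 expR0 mul1r; apply => s /andP[ts _].
by have := dDle s (le_lt_trans Tt ts); lra.
Qed.

Lemma energy_gap_decay (c T : R) : 0 <= T ->
  (forall t, T < t -> c * (g t - ginf) <= D t) ->
  forall t, T <= t -> g t - ginf <= expR (- (c * (t - T))) * (g T - ginf).
Proof.
move=> T0 cD_ t Tt.
apply: (gronwall_decay T0 Tt continuous_energy_gap is_derive_energy_gap).
by move=> s /andP[Ts _]; rewrite mulNr lerN2 cD_.
Qed.

Variable lam : R.
Hypotheses (lam0 : 0 < lam)
  (dD_bounded : forall T, exists K, forall t, 0 < t < T -> `|dD t| <= K * D t)
  (dD_asymptotic : forall eps, 0 < eps ->
     exists2 T, 0 < T & forall t, T < t -> dD t <= - (2 * (lam - eps)) * D t).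

Lemma asymptotic_decay eps : 0 < eps -> exists2 T : R, 0 < T & forall t, T < t ->
  g t - ginf <= expR (- (2 * (lam - eps) * (t - T))) * (g T - ginf).
Proof.
move=> /dD_asymptotic[T T0 dDle]; exists T => // t Tt.
apply: energy_gap_decay (ltW T0) _ _ (ltW Tt) => s Ts.
exact: dissipation_ge_gap (ltW T0) dDle _ (ltW Ts).
Qed.

(** On [[0, T]] the bound on [dD] traps [D t] between [expR (- (K * t)) * D 0] and
    [expR (K * t) * D 0]. If [D 0] were 0, the energy would be constant up to the
    time [T] after which it is dominated by [D], so there would be no gap. Hence
    [D] has a positive lower bound on [[0, T]], where [g - ginf] is at most its
    initial value. This replaces the uniqueness theorem for the equation, which
    would exclude reaching an equilibrium in finite time. *)
Lemma global_decay : exists2 C : R, 0 < C & forall t, 0 <= t ->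
  g t - ginf <= expR (- (C * t)) * (g 0 - ginf).
Proof.
(* Without an energy gap at time 0 the energy is constant. *)
have [gap0|gap0] := leP (g 0 - ginf) 0.
  exists 1 => // t t0; have := energy_nonincreasing (lexx 0) t0.
  have := energy_ge_limit (lexx 0) => ginf0 gt.
  have -> : g 0 - ginf = 0 by apply/eqP; rewrite eq_le gap0 subr_ge0.
  by rewrite mulr0; lra.
(* The choice [eps = lam / 2] gives the rate [lam]; any positive rate would do. *)
have [T T0 dDle] : exists2 T, 0 < T & forall t, T < t -> dD t <= - lam * D t.
  have [|T T0 dDle] := dD_asymptotic (eps := lam / 2); first by rewrite divr_gt0.
  exists T => // t /dDle; congr (_ <= - _ * _); by field.
have cle := dissipation_ge_gap (ltW T0) dDle.
have [K DK] := dD_bounded T.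
have Dup t : 0 <= t <= T -> D t <= expR (K * t) * D 0.
  move=> /andP[t0 tT].
  have := gronwall_decay (lexx 0) t0 cD dDt (c := - K).
  rewrite subr0 mulNr !opprK; apply => s /andP[s0 st].
  by apply: le_trans (ler_norm _) _; rewrite DK// s0 (lt_le_trans st).
have Dlow t : 0 <= t <= T -> expR (- (K * t)) * D 0 <= D t.
  move=> /andP[t0 tT].
  have cND : {within `[0, +oo[, continuous (fun s => -1 * D s)}.
    by move=> x; apply: cvgM; [exact: cvg_cst | exact: cD].
  have dND s (s0 : 0 < s) := is_derive_mull (-1) (dDt s0).
  have := gronwall_decay (lexx 0) t0 cND dND (c := K).
  rewrite subr0 !mulN1r mulrN lerN2; apply => s /andP[s0 st].
  rewrite !mulN1r mulrNN; apply: le_trans (ler_norm _) _; rewrite normrN.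
  by rewrite DK// s0 (lt_le_trans st).
have D00 : 0 < D 0.
  rewrite lt_neqAle D0// andbT; apply/eqP => D00.
  have Dz t : 0 <= t <= T -> D t <= 0 by move=> /Dup; rewrite -D00 mulr0.
  have gT : g 0 <= g T.
    have cNg : {within `[0, +oo[, continuous (fun s => -1 * g s)}.
      by move=> x; apply: cvgM; [exact: cvg_cst | exact: cg].
    have dNg s (s0 : 0 < s) := is_derive_mull (-1) (dg s0).
    have := gronwall_decay (lexx 0) (ltW T0) cNg dNg (c := 0).
    rewrite mul0r oppr0 expR0 mul1r !mulN1r lerN2; apply => s /andP[s0 sT].
    by rewrite mul0r mulN1r opprK Dz// ltW//= ltW.
  have := cle T (lexx T); have := Dz T; rewrite lexx ltW// => /(_ isT).
  have : 0 < lam * (g T - ginf).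
    by apply: mulr_gt0; [exact: lam0 | rewrite subr_gt0 (lt_le_trans _ gT)// -subr_gt0].
  by move=> /lt_le_trans h1 h2 /h1 /lt_le_trans /(_ h2); rewrite ltxx.
(* On [[0, T]] the ratio of [D] to the energy gap is at least [m]. *)
pose m := expR (- (`|K| * T)) * D 0 / (g 0 - ginf).
have m0 : 0 < m by rewrite divr_gt0// mulr_gt0// expR_gt0.
exists (Num.min m lam); first by rewrite lt_min m0 lam0.
move=> t t0; have := energy_gap_decay (c := Num.min m lam) (lexx 0) _ t0.
rewrite subr0; apply => s s0.
have gap_s := energy_ge_limit (ltW s0).
have [Ts|sT] := leP T s.
  apply: le_trans (cle s Ts); apply: ler_wpM2r; first by rewrite subr_ge0.
  by rewrite ge_min lexx orbT.
apply: (@le_trans _ _ (m * (g 0 - ginf))).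
  apply: ler_pM; rewrite ?subr_ge0 ?le_min ?(ltW m0) ?(ltW lam0) ?ge_min ?lexx//.
  by rewrite lerD2r energy_nonincreasing// ltW.
rewrite /m divfK ?gt_eqF//; apply: le_trans (Dlow s _); last by rewrite !ltW.
rewrite ler_wpM2r ?(ltW D00)// ler_expR lerN2.
apply: (@le_trans _ _ (`|K| * s)); first by rewrite ler_wpM2r ?ler_norm// ltW.
by rewrite ler_wpM2l// ltW.
Qed.

End EntropyDecay.

(** * The second-order form near an equilibrium *)

(** By [p u * p z <= (p u ^+ 2 + p z ^+ 2) / 2]. *)
Lemma quadratic_form_le (R : realFieldType) (I : finType) (P : pred I)
    (c : I -> I -> R) (p : I -> R) (B : R) :
  (forall u z, `|c u z| <= B) ->
  `|\sum_(u | P u) \sum_(z | P z) c u z * (p u * p z)| <=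
    B * #|P|%:R * \sum_(u | P u) p u ^+ 2.
Proof.
move=> cB; apply: le_trans (ler_norm_sum _ _ _) _.
apply: (@le_trans _ _ (\sum_(u | P u) \sum_(z | P z)
    B * (2^-1 * (p u ^+ 2 + p z ^+ 2)))).
  apply: ler_sum => u _; apply: le_trans (ler_norm_sum _ _ _) _.
  apply: ler_sum => z _; rewrite normrM; apply: ler_pM => //.
  rewrite ler_norml; apply/andP; split.
    have := sqr_ge0 (p u + p z); lra.
  have := sqr_ge0 (p u - p z); lra.
under eq_bigr do rewrite -mulr_sumr -mulr_sumr big_split /= sumr_const.
rewrite -mulr_sumr -mulr_sumr big_split /= sumr_const.
have -> : \sum_(u | P u) p u ^+ 2 *+ #|P| = (\sum_(u | P u) p u ^+ 2) *+ #|P|.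
  by rewrite -sumrMnl.
by rewrite -mulr_natl le_eqVlt; apply/orP; left; apply/eqP; field.
Qed.

Section FormBounds.
Variables (R : realType) (n : nat) (e : rel 'I_n) (dx beta : R).
Variables (v : 'rV[R]_n) (w : 'M[R]_n).
Hypotheses (dx0 : 0 < dx) (wT : w^T = w).
Implicit Types (x Phi : 'rV[R]_n).

Local Notation N := (#|edge e|%:R : R).
Let S Phi : R := \sum_(u | edge e u) slope dx Phi u ^+ 2.

Lemma slope_scale c Phi u : 0 <= c -> slope dx (c *: Phi) u = c * slope dx Phi u.
Proof. by move=> c0; rewrite /slope !mxE -mulrBr -mulrA pos_partZ. Qed.

Lemma dissipation_ge0 x Phi : (forall i, 0 < x 0 i) -> 0 <= dissipation e dx x Phi.
Proof. by move=> x0; apply: sumr_ge0 => u _; rewrite mulr_ge0 ?sqr_ge0// ltW. Qed.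

(** Where the densities are bounded below, the dissipation controls the slopes; all
    error terms are estimated through [S]. *)
Lemma slope_sum_le x Phi (B : R) : (forall i, 0 < x 0 i) ->
  (forall i, (x 0 i)^-1 <= B) -> S Phi <= B * dissipation e dx x Phi.
Proof.
move=> x0 xB; rewrite mulr_sumr; apply: ler_sum => u _.
rewrite mulrCA ler_peMr ?sqr_ge0//.
by have := xB u.1; rewrite -[leLHS]mul1r ler_pdivrMr.
Qed.

(** Both sides are homogeneous of degree 2 in [Phi], because the slopes are
    positively homogeneous; the definition of [lambdaF] is the case of dissipation 1.
    If the dissipation of [Phi] is 0 then all its slopes vanish. As [lambdaF] is
    positive it is not the default value 0, hence a true lower bound. *)
Lemma lambda_form_ge x Phi : (forall i, 0 < x 0 i) ->
  0 < lambdaF e dx beta v w x ->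
  lambdaF e dx beta v w x * dissipation e dx x Phi <= edge_form e dx beta w x Phi.
Proof.
move=> x0; rewrite /lambdaF /set_min; case: xgetP => [y yE [_ ylb] y0|]; last first.
  by rewrite ltxx.
have S0 := dissipation_ge0 Phi x0.
have [s0|s_le0] := ltP 0 (dissipation e dx x Phi); last first.
  have d0 : dissipation e dx x Phi = 0 by apply/eqP; rewrite eq_le s_le0.
  have p0 u : edge e u -> slope dx Phi u = 0.
    move=> eu; apply/eqP; rewrite -sqrf_eq0.
    have := d0; rewrite /dissipation; move/eqP; rewrite psumr_eq0; last first.
      by move=> z _; rewrite mulr_ge0 ?sqr_ge0// ltW.
    move=> /allP/(_ u (mem_index_enum u))/implyP/(_ eu).
    by rewrite mulf_eq0 (gt_eqF (x0 u.1)) orbF.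
  rewrite d0 mulr0 /edge_form big1 // => u eu; rewrite big1 // => z _.
  by rewrite p0// mul0r mulr0.
pose c := (Num.sqrt (dissipation e dx x Phi))^-1.
have c0 : 0 <= c by rewrite invr_ge0 sqrtr_ge0.
have c2 : c ^+ 2 = (dissipation e dx x Phi)^-1 by rewrite exprVn sqr_sqrtr.
have dc : dissipation e dx x (c *: Phi) = 1.
  rewrite /dissipation; under eq_bigr do rewrite slope_scale// exprMn -mulrA.
  by rewrite -mulr_sumr c2 mulVf// gt_eqF.
have fc : edge_form e dx beta w x (c *: Phi) =
    (dissipation e dx x Phi)^-1 * edge_form e dx beta w x Phi.
  rewrite /edge_form mulr_sumr; apply: eq_bigr => u _; rewrite mulr_sumr.
  by apply: eq_bigr => z _; rewrite !slope_scale// -c2; ring.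
have : y <= lambda_form e dx beta v w x (c *: Phi).
  by apply: ylb; exists (c *: Phi) => //; rewrite lambda_domE.
by rewrite lambda_formE// fc mulrC ler_pdivlMr.
Qed.

(** The derivative of the dissipation along the flow, at the density [x]
    (see [is_derive_dissipation_flow]). *)
Definition dissipation_rate x : R :=
  - 2 * edge_form e dx beta w x (potential beta v w x)
  + \sum_(u | edge e u) slope dx (potential beta v w x) u ^+ 2
                        * efield e dx beta v w u.1 x.

Let P x := potential beta v w x.

Lemma transport_le x (c : R) : (forall i, `|efield e dx beta v w i x| <= c) ->
  `|\sum_(u | edge e u) slope dx (P x) u ^+ 2 * efield e dx beta v w u.1 x|
    <= c * S (P x).
Proof.
move=> xc; apply: le_trans (ler_norm_sum _ _ _) _; rewrite mulr_sumr.
apply: ler_sum => u _; rewrite normrM [`|_ ^+ 2|]ger0_norm ?sqr_ge0// mulrC.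
by rewrite ler_wpM2r ?sqr_ge0.
Qed.

Lemma dissipation_rate_bounded x (B : R) : 0 <= B -> (forall i, 0 < x 0 i) ->
  (forall i, (x 0 i)^-1 <= B) ->
  (forall u z, `|coef dx beta w x u z| <= B) ->
  (forall i, `|efield e dx beta v w i x| <= B) ->
  `|dissipation_rate x| <= (2 * N + 1) * B * B * dissipation e dx x (P x).
Proof.
move=> B0 x0 xB cB fB; apply: le_trans (ler_normD _ _) _.
rewrite normrM normrN [`|2|]ger0_norm//.
have h1 := quadratic_form_le (edge e) (slope dx (P x)) cB.
have h2 := transport_le fB.
apply: (@le_trans _ _ ((2 * N + 1) * B * S (P x))).
  apply: le_trans (lerD (ler_wpM2l (ler0n _ 2) h1) h2) _.
  rewrite -/(S _) le_eqVlt; apply/orP; left; apply/eqP; ring.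
rewrite -[leRHS]mulrA ler_wpM2l ?slope_sum_le//.
by rewrite mulr_ge0// addr_ge0// mulr_ge0.
Qed.

(** Replacing [x] by [xinf] in the coefficients of the form and in the weights of
    the dissipation costs a multiple of [eta * S], and so does the transport term;
    [S] is at most [B] times the dissipation. *)
Lemma dissipation_rate_near x (xinf : 'rV[R]_n) (B eta : R) : 0 <= eta ->
  (forall i, 0 < x 0 i) -> (forall i, 0 < xinf 0 i) ->
  0 < lambdaF e dx beta v w xinf ->
  (forall i, (x 0 i)^-1 <= B) ->
  (forall i, `|x 0 i - xinf 0 i| <= eta) ->
  (forall u z, `|coef dx beta w x u z - coef dx beta w xinf u z| <= eta) ->
  (forall i, `|efield e dx beta v w i x| <= eta) ->
  dissipation_rate x <=
    - (2 * (lambdaF e dx beta v w xinf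
            - eta * ((lambdaF e dx beta v w xinf + N + 1) * B)))
    * dissipation e dx x (P x).
Proof.
move=> eta0 x0 xinf0 lam0 xB xeta ceta feta.
have h1 := quadratic_form_le (edge e) (slope dx (P x)) ceta.
have h2 := transport_le feta.
have h3 := lambda_form_ge (P x) xinf0 lam0.
have h4 := slope_sum_le (P x) x0 xB.
set lam := lambdaF _ _ _ _ _ _ in lam0 h3 *.
have S0 : 0 <= S (P x) by apply: sumr_ge0 => u _; exact: sqr_ge0.
have h5 : dissipation e dx x (P x) - eta * S (P x) <= dissipation e dx xinf (P x).
  rewrite mulr_sumr /dissipation -sumrB; apply: ler_sum => u _.
  rewrite mulrC -mulrBl mulrC ler_wpM2l ?sqr_ge0//.
  by have := xeta u.1; rewrite ler_norml => /andP[_]; lra.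
have h6 : edge_form e dx beta w xinf (P x) - eta * N * S (P x) <=
    edge_form e dx beta w x (P x).
  rewrite lerBlDr -lerBlDl; apply: le_trans h1.
  rewrite -normrN; apply: le_trans (ler_norm _).
  rewrite le_eqVlt; apply/orP; left; apply/eqP.
  rewrite /edge_form -sumrB -sumrN; apply: eq_bigr => u _.
  rewrite -sumrB -sumrN; apply: eq_bigr => z _; ring.
have h7 : lam * (dissipation e dx x (P x) - eta * S (P x)) <=
    lam * dissipation e dx xinf (P x) by rewrite ler_wpM2l// ltW.
have h8 : eta * (lam + N + 1) * S (P x) <=
    eta * (lam + N + 1) * (B * dissipation e dx x (P x)).
  by rewrite ler_wpM2l// mulr_ge0// !addr_ge0// ltW.
have h9 := le_trans (ler_norm _) h2.
have h10 : 0 <= eta * S (P x) by rewrite mulr_ge0.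
rewrite /dissipation_rate -/(P x); move: h3 h6 h7 h8 h9 h10.
set I := dissipation e dx x _; set I' := dissipation e dx xinf _.
set Q := edge_form _ _ _ _ x _; set Q' := edge_form _ _ _ _ xinf _.
set V := \sum_(u | _) _; set s := S _; move: N => k.
move: I I' Q Q' V s => I I' Q Q' V s; lra.
Qed.

End FormBounds.

(** * Solutions of the Fokker-Planck equation *)

Section Solution.
Variables (R : realType) (n : nat) (e : rel 'I_n) (dx beta : R).
Variables (v : 'rV[R]_n) (w : 'M[R]_n) (rho0 : 'rV[R]_n) (rho : R -> 'rV[R]_n).
Hypotheses (dx0 : 0 < dx) (esym : symmetric e) (wT : w^T = w).
Hypothesis sol : fp_solution e dx beta v w rho0 rho.
Implicit Types (x : 'rV[R]_n) (f : 'rV[R]_n -> R) (t : R).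

Lemma solution_gt0 t i : 0 <= t -> 0 < rho t 0 i.
Proof. by case: sol => _ + _ _ => /[apply] -[]. Qed.

Lemma is_derive_solution_coord t i : 0 < t ->
  is_derive t 1 (fun s => rho s 0 i) (efield e dx beta v w i (rho t)).
Proof.
move=> t0; have [_ _ _ /(_ t t0)[drho rhoE]] := sol.
have rho_t j := solution_gt0 j (ltW t0).
split; first exact: (derivable_mxP _ _ _).1.
by rewrite -(@fp_fieldE _ _ e _ beta v w dx0 wT _ rho_t) -rhoE derive_mx// mxE.
Qed.

Lemma continuous_along_solution f :
  (forall x, (forall i, 0 < x 0 i) -> {for x, continuous f}) ->
  {within `[0, +oo[, continuous (f \o rho)}.
Proof.
move=> cf; have [_ _ crho _] := sol.
apply/subspace_continuousP => t; rewrite /= in_itv /= andbT => t0.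
apply: (@continuous_cvg _ _ _ _ _ rho f).
  by apply: cf => i; exact: solution_gt0.
by move/subspace_continuousP : crho; apply; rewrite /= in_itv /= andbT.
Qed.

Lemma solution_bounded (T : R) (I : finType) (f : I -> 'rV[R]_n -> R) :
  (forall k x, (forall i, 0 < x 0 i) -> {for x, continuous (f k)}) ->
  exists2 B : R, 0 <= B & forall k t, 0 < t < T -> `|f k (rho t)| <= B.
Proof.
move=> cf.
have /choice[B BP] : forall k, exists B : R, forall t, 0 <= t <= T ->
    `|f k (rho t)| <= B.
  by move=> k; exact: (@bounded_on_segment _ T (f k \o rho)
    (@continuous_along_solution (f k) (cf k))).
exists (\sum_k `|B k|) => [|k t /andP[t0 tT]]; first exact: sumr_ge0.
rewrite (bigD1 k) //= ler_wpDr ?sumr_ge0//.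
by apply: le_trans (ler_norm _); apply: BP; rewrite !ltW.
Qed.

Section Limit.
Variable rhoinf : 'rV[R]_n.
Hypotheses (lim_rho : rho t @[t --> +oo] --> rhoinf)
  (rhoinf0 : forall i, 0 < rhoinf 0 i).

Lemma cvg_along_solution f : {for rhoinf, continuous f} ->
  f (rho t) @[t --> +oo] --> f rhoinf.
Proof. by move=> cf; exact: (@continuous_cvg _ _ _ _ _ rho f). Qed.

Lemma near_infinity (I : finType) (f : I -> 'rV[R]_n -> R) (eta : R) : 0 < eta ->
  (forall k, {for rhoinf, continuous (f k)}) ->
  \forall t \near +oo, forall k, `|f k (rho t) - f k rhoinf| <= eta.
Proof.
move=> eta0 cf; apply: filter_forall => k.
have /cvgrPdist_le/(_ eta eta0) := cvg_along_solution (cf k).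
by apply: filterS => t; rewrite distrC.
Qed.

End Limit.

Let D t := dissipation e dx (rho t) (potential beta v w (rho t)).

Lemma dissipation_bounded_rate (T : R) : exists K : R, forall t, 0 < t < T ->
  `|dissipation_rate e dx beta v w (rho t)| <= K * D t.
Proof.
have [|B1 B10 B1P] := @solution_bounded T 'I_n (fun i x => (x 0 i)^-1).
  by move=> i x x0; exact: continuous_at_inv_coord.
have [|B2 B20 B2P] := @solution_bounded T
    (('I_n * 'I_n) * ('I_n * 'I_n))%type
    (fun k x => coef dx beta w x k.1 k.2).
  by move=> k x x0; exact: continuous_at_coef.
have [|B3 B30 B3P] := @solution_bounded T 'I_n (efield e dx beta v w).
  by move=> i x x0; exact: continuous_at_efield.
have B_ge0 : 0 <= B1 + B2 + B3 by rewrite !addr_ge0.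
exists ((2 * #|edge e|%:R + 1) * (B1 + B2 + B3) * (B1 + B2 + B3)) => t tT.
have t0 : 0 <= t by case/andP: tT => /ltW.
apply: dissipation_rate_bounded => // [i|i|u z|i].
- exact: solution_gt0.
- by apply: le_trans (ler_norm _) _; have := B1P i t tT; lra.
- by have := B2P (u, z) t tT => /= ?; lra.
- by have := B3P i t tT; lra.
Qed.

Lemma asymptotic_rate (rhoinf : 'rV[R]_n) (eps : R) :
  rho t @[t --> +oo] --> rhoinf -> (forall i, 0 < rhoinf 0 i) ->
  (forall i, efield e dx beta v w i rhoinf = 0) ->
  0 < lambdaF e dx beta v w rhoinf -> 0 < eps ->
  exists2 T : R, 0 < T & forall t, T < t ->
    dissipation_rate e dx beta v w (rho t) <=
      - (2 * (lambdaF e dx beta v w rhoinf - eps)) * D t.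
Proof.
move=> lim_rho rhoinf0 eq_rhoinf lam0 eps0.
set lam := lambdaF _ _ _ _ _ _ in lam0 *.
have inv0 i : 0 <= (rhoinf 0 i)^-1 by rewrite invr_ge0 ltW.
(* [B] bounds the inverse densities once they are within 1 of their limits. *)
pose B := \sum_i (rhoinf 0 i)^-1 + 1.
have B0 : 0 <= B by rewrite addr_ge0// sumr_ge0.
pose K := (lam + #|edge e|%:R + 1) * B.
have K0 : 0 <= K by rewrite mulr_ge0// !addr_ge0// ltW.
(* [eta] is the tolerance for which the loss [eta * K] of
   [dissipation_rate_near] is at most [eps]. *)
pose eta := eps / (K + 1).
have eta0 : 0 < eta by rewrite divr_gt0// ltr_wpDl.
have etaK : eta * K <= eps.
  by rewrite mulrAC ler_pdivrMr ?ltr_wpDl// ler_pM2l// lerDl.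
have near_x := near_infinity lim_rho eta0
  (fun i => @continuous_at_coord R n rhoinf i).
have near_inv := near_infinity lim_rho ltr01
  (fun i => @continuous_at_inv_coord R n rhoinf rhoinf0 i).
have near_coef := near_infinity lim_rho eta0
  (I := (('I_n * 'I_n) * ('I_n * 'I_n))%type) (f := fun k x => coef dx beta w x k.1 k.2)
  (fun k => @continuous_at_coef R n dx beta w rhoinf rhoinf0 k.1 k.2).
have near_efield := near_infinity lim_rho eta0
  (fun i => @continuous_at_efield R n e dx beta v w rhoinf rhoinf0 i).
have [M [_ MP]] : \forall t \near +oo, 0 <= t ->
    dissipation_rate e dx beta v w (rho t) <= - (2 * (lam - eps)) * D t.
  near=> t => t0.
  have rho_t i := solution_gt0 i t0.
  have D0 := dissipation_ge0 e dx (potential beta v w (rho t)) rho_t.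
  apply: (@le_trans _ _ (- (2 * (lam - eta * K)) * D t)); last first.
    by rewrite ler_wpM2r// lerN2 ler_pM2l// lerD2l lerN2.
  apply: dissipation_rate_near => //; first exact: ltW.
  - move=> i; have : `|(rho t 0 i)^-1 - (rhoinf 0 i)^-1| <= 1.
      by move: i; near: t; exact: near_inv.
    rewrite ler_norml lerBlDl => /andP[_ /le_trans]; apply.
    by rewrite /B (bigD1 i) //= -addrA lerD2l lerDr sumr_ge0.
  - by near: t; exact: near_x.
  - move=> u z; have : forall k : ('I_n * 'I_n) * ('I_n * 'I_n),
        `|coef dx beta w (rho t) k.1 k.2 - coef dx beta w rhoinf k.1 k.2| <= eta.
      by near: t; exact: near_coef.
    by move/(_ (u, z)).
  - move=> i; have : `|efield e dx beta v w i (rho t)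
        - efield e dx beta v w i rhoinf| <= eta.
      by move: i; near: t; exact: near_efield.
    by rewrite eq_rhoinf subr0.
exists (Num.max M 1); first by rewrite lt_max ltr01 orbT.
move=> t; rewrite gt_max => /andP[Mt t1]; apply: MP => //.
by rewrite (le_trans ler01)// ltW.
Unshelve. all: by end_near. Qed.

End Solution.

Lemma dissipation_equilibrium (R : realType) (n : nat) (e : rel 'I_n) (dx beta : R)
    (v : 'rV[R]_n) (w : 'M[R]_n) (x : 'rV[R]_n) : symmetric e ->
  (forall i, efield e dx beta v w i x = 0) ->
  dissipation e dx x (potential beta v w x) = 0.
Proof.
move=> esym x0; apply/eqP; rewrite -oppr_eq0 -energy_flow//.
by rewrite big1// => i _; rewrite x0 mulr0.
Qed.

Theorem theorem7 (R : realType) (n : nat) (hn : (2 <= n)%N)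
    (e : rel 'I_n) (he : simple_connected_graph e)
    (dx beta : R) (hdx : 0 < dx) (hbeta : 0 < beta)
    (v : 'rV[R]_n) (w : 'M[R]_n) (hw : w^T = w)
    (rho0 : 'rV[R]_n) (hrho0 : prob_interior rho0)
    (rho : R -> 'rV[R]_n) (hrho : fp_solution e dx beta v w rho0 rho)
    (rhoinf : 'rV[R]_n) (hlim : rho t @[t --> +oo] --> rhoinf)
    (hiso : isolated (fp_equilibrium e dx beta v w) rhoinf)
    (hlambda : 0 < lambdaF e dx beta v w rhoinf) :
  let F := free_energy beta v w in
  let lam := lambdaF e dx beta v w rhoinf in
  (exists2 C : R, 0 < C &
     forall t : R, 0 <= t ->
       F (rho t) - F rhoinf <= expR (- (C * t)) * (F rho0 - F rhoinf)) /\
  (exists2 eps0 : R, 0 < eps0 &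
     forall eps : R, 0 < eps -> eps < eps0 ->
       exists2 T : R, 0 < T &
         forall t : R, T < t ->
           F (rho t) - F rhoinf <=
             expR (- (2 * (lam - eps) * (t - T))) * (F (rho T) - F rhoinf)).
Proof.
move=> F lam; have [esym _ _] := he.
have [[_ rhoinf0] field0] := isolatedS hiso.
have eq_rhoinf i : efield e dx beta v w i rhoinf = 0.
  by rewrite -(@fp_fieldE _ _ e _ beta v w hdx hw _ rhoinf0) field0 mxE.
have rho_gt0 t i (t0 : 0 <= t) := solution_gt0 hrho i t0.
have drho t i (t0 : 0 < t) := is_derive_solution_coord hdx hw hrho i t0.
pose D t := dissipation e dx (rho t) (potential beta v w (rho t)).
pose dD t := dissipation_rate e dx beta v w (rho t).
have cg : {within `[0, +oo[, continuous (F \o rho)}.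
  apply: (continuous_along_solution hrho) => x; exact: continuous_at_free_energy.
have cD : {within `[0, +oo[, continuous D}.
  apply: (@continuous_along_solution _ _ _ _ _ _ _ _ _ hrho
    (fun x => dissipation e dx x (potential beta v w x))) => x.
  exact: continuous_at_dissipation.
have dg (t : R) (t0 : 0 < t) : is_derive t 1 (F \o rho) (- D t).
  apply: is_derive_energy_flow => // i; first exact: drho.
  exact: rho_gt0 (ltW t0).
have dDt (t : R) (t0 : 0 < t) : is_derive t 1 D (dD t).
  apply: is_derive_dissipation_flow => // i; first exact: drho.
  exact: rho_gt0 (ltW t0).
have D0 (t : R) (t0 : 0 <= t) : 0 <= D t.
  by apply: dissipation_ge0 => i; exact: rho_gt0.
have glim : (F \o rho) t @[t --> +oo] --> F rhoinf.
  apply: (cvg_along_solution hlim); exact: continuous_at_free_energy.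
have Dlim : D t @[t --> +oo] --> (0 : R).
  rewrite -(dissipation_equilibrium esym eq_rhoinf).
  apply: (@cvg_along_solution _ _ _ _ hlim
    (fun x => dissipation e dx x (potential beta v w x))).
  exact: continuous_at_dissipation.
have dDb := dissipation_bounded_rate hrho.
have dDa eps := asymptotic_rate hw hrho hlim rhoinf0 eq_rhoinf hlambda (eps := eps).
split.
  have [C C0 CP] := global_decay cg cD dg dDt D0 glim Dlim hlambda dDb dDa.
  have [rho_init _ _ _] := hrho.
  by exists C => // t /CP; rewrite /= rho_init.
exists 1 => // eps eps0 _.
exact: (asymptotic_decay cg cD dg dDt glim Dlim dDa eps0).
Qed.
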